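(* (i) A geometric sequent $\sigma$ over the signature of $\mathbb{L}_u$ is valid in all abelian $\ell$-groups with strong unit in $\mathbf{Set}$ if and only if it is provable in $\mathbb{L}_u$. (ii) For any family $\{\phi_i\}_{i\in I}$ of geometric sentences over the signature of $\mathbb{L}_u$, the sequent $\top\vdash\bigvee_{i\in I}\phi_i$ is provable in $\mathbb{L}_u$ (equivalently, every abelian $\ell$-group with strong unit in $\mathbf{Set}$ satisfies at least one $\phi_i$) if and only if there exists a finite subset $J\subseteq I$ such that $\top\vdash\bigvee_{i\in J}\phi_i$ is provable in $\mathbb{L}_u$ (equivalently, every abelian $\ell$-group with strong unit in $\mathbf{Set}$ satisfies at least one $\phi_i$ with $i\in J$).
   Context: $\mathbb{L}_u$ is the one-sorted geometric theory over the signature with function symbols $+,-,\sup,\inf$, relation symbol $\le$ and constants $0,u$, with axioms: $(+,-,0)$ is an abelian group; $\le$ is a partial order; $\inf,\sup$ are binary infimum and supremum; $x\le y\vdash_{x,y,t}t+x\le t+y$; $\top\vdash u\ge0$; $x\ge0\vdash_x\bigvee_{n\in\mathbb{N}}x\le nu$. Provability is in geometric logic (formulae built from atomic ones using finite conjunctions, arbitrary disjunctions and existential quantification). A geometric sentence is a geometric formula with no free variables. *)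

(* Defs.v *)
From Stdlib Require List.
From mathcomp Require Import all_boot.
Set Implicit Arguments. Unset Strict Implicit. Unset Printing Implicit Defensive.

(* Syntax: well-scoped terms and geometric formulae over the signature *)
(* of L_u.  A term/formula "in context n" has free variables among     *)
(* 'I_n (de Bruijn style; variable ord0 is the most recently bound).  *)

Inductive term (n : nat) : Type :=
| tvar of 'I_n
| tzero
| tunit
| tadd of term n & term n
| topp of term n
| tsup of term n & term n
| tinf of term n & term n.
Arguments tzero {n}. Arguments tunit {n}.

Inductive formula : nat -> Type :=
| fTop n : formula n
| fAnd n : formula n -> formula n -> formula n
| fOr n (I : Type) : (I -> formula n) -> formula n
| fEq n : term n -> term n -> formula n
| fLe n : term n -> term n -> formula n
| fEx n : formula n.+1 -> formula n.
Arguments fTop {n}.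

Definition scons (T : Type) m (a : T) (s : 'I_m -> T) : 'I_m.+1 -> T :=
  fun i => match unlift ord0 i with None => a | Some j => s j end.

Fixpoint tsubst n m (s : 'I_n -> term m) (t : term n) : term m :=
  match t with
  | tvar i => s i
  | tzero => tzero
  | tunit => tunit
  | tadd a b => tadd (tsubst s a) (tsubst s b)
  | topp a => topp (tsubst s a)
  | tsup a b => tsup (tsubst s a) (tsubst s b)
  | tinf a b => tinf (tsubst s a) (tsubst s b)
  end.

Definition tshift n (t : term n) : term n.+1 :=
  tsubst (fun i => tvar (lift ord0 i)) t.

Definition sup_subst n m (s : 'I_n -> term m) : 'I_n.+1 -> term m.+1 :=
  scons (tvar ord0) (fun i => tshift (s i)).

Fixpoint fsubst n (f : formula n) : forall m, ('I_n -> term m) -> formula m :=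
  match f in formula n return forall m, ('I_n -> term m) -> formula m with
  | @fTop _ => fun m _ => fTop
  | @fAnd _ a b => fun m s => fAnd (fsubst a s) (fsubst b s)
  | @fOr _ K g => fun m s => fOr (fun i : K => fsubst (g i) s)
  | @fEq _ a b => fun m s => fEq (tsubst s a) (tsubst s b)
  | @fLe _ a b => fun m s => fLe (tsubst s a) (tsubst s b)
  | @fEx _ g => fun m s => fEx (fsubst g (sup_subst s))
  end.

Definition fshift n (f : formula n) : formula n.+1 :=
  fsubst f (fun i => tvar (lift ord0 i)).

(* Deduction system for geometric logic (Johnstone, Elephant D1.3.1). *)

Section Deduction.
Variable Ax : forall n, formula n -> formula n -> Prop.

(* in context n.+2: x := var 0, y := var 1, the others are var (k+2) *)
Definition eq_sx n : 'I_n.+1 -> term n.+2 :=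
  scons (tvar ord0) (fun j => tvar (lift ord0 (lift ord0 j))).
Definition eq_sy n : 'I_n.+1 -> term n.+2 :=
  scons (tvar (lift ord0 ord0)) (fun j => tvar (lift ord0 (lift ord0 j))).

Inductive Provable : forall n, formula n -> formula n -> Prop :=
| pr_ax n (phi psi : formula n) : Ax phi psi -> Provable phi psi
| pr_id n (phi : formula n) : Provable phi phi
| pr_cut n (phi psi chi : formula n) :
    Provable phi psi -> Provable psi chi -> Provable phi chi
| pr_subst n m (s : 'I_n -> term m) (phi psi : formula n) :
    Provable phi psi -> Provable (fsubst phi s) (fsubst psi s)
| pr_eq_refl : Provable (@fTop 1) (fEq (tvar ord0) (tvar ord0))
| pr_eq_repl n (phi : formula n.+1) :
    Provable (fAnd (fEq (tvar ord0) (tvar (lift ord0 ord0))) (fsubst phi (@eq_sx n)))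
             (fsubst phi (@eq_sy n))
| pr_top n (phi : formula n) : Provable phi fTop
| pr_and_l n (phi psi : formula n) : Provable (fAnd phi psi) phi
| pr_and_r n (phi psi : formula n) : Provable (fAnd phi psi) psi
| pr_and_i n (phi psi chi : formula n) :
    Provable phi psi -> Provable phi chi -> Provable phi (fAnd psi chi)
| pr_or_i n (I : Type) (f : I -> formula n) (i : I) : Provable (f i) (fOr f)
| pr_or_e n (I : Type) (f : I -> formula n) (psi : formula n) :
    (forall i, Provable (f i) psi) -> Provable (fOr f) psi
| pr_ex_e n (phi : formula n.+1) (psi : formula n) :
    Provable phi (fshift psi) -> Provable (fEx phi) psi
| pr_ex_i n (phi : formula n.+1) (psi : formula n) :
    Provable (fEx phi) psi -> Provable phi (fshift psi)
| pr_distr n (phi : formula n) (I : Type) (f : I -> formula n) :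
    Provable (fAnd phi (fOr f)) (fOr (fun i => fAnd phi (f i)))
| pr_frob n (phi : formula n) (psi : formula n.+1) :
    Provable (fAnd phi (fEx psi)) (fEx (fAnd (fshift phi) psi)).
End Deduction.

Fixpoint tnat_u n (k : nat) : term n :=
  match k with 0 => tzero | k.+1 => tadd (tnat_u n k) tunit end.

Definition v1 : term 1 := tvar ord0.
Definition v2 (k : nat) : term 2 := tvar (@inord 1 k).
Definition v3 (k : nat) : term 3 := tvar (@inord 2 k).

Inductive Lu_axiom : forall n, formula n -> formula n -> Prop :=
| ax_addA : Lu_axiom fTop (fEq (tadd (tadd (v3 0) (v3 1)) (v3 2))
                               (tadd (v3 0) (tadd (v3 1) (v3 2))))
| ax_addC : Lu_axiom fTop (fEq (tadd (v2 0) (v2 1)) (tadd (v2 1) (v2 0)))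
| ax_add0 : Lu_axiom fTop (fEq (tadd v1 tzero) v1)
| ax_addN : Lu_axiom fTop (fEq (tadd v1 (topp v1)) tzero)
| ax_le_refl : Lu_axiom fTop (fLe v1 v1)
| ax_le_trans : Lu_axiom (fAnd (fLe (v3 0) (v3 1)) (fLe (v3 1) (v3 2)))
                         (fLe (v3 0) (v3 2))
| ax_le_anti : Lu_axiom (fAnd (fLe (v2 0) (v2 1)) (fLe (v2 1) (v2 0)))
                        (fEq (v2 0) (v2 1))
| ax_sup_l : Lu_axiom fTop (fLe (v2 0) (tsup (v2 0) (v2 1)))
| ax_sup_r : Lu_axiom fTop (fLe (v2 1) (tsup (v2 0) (v2 1)))
| ax_sup_lub : Lu_axiom (fAnd (fLe (v3 0) (v3 2)) (fLe (v3 1) (v3 2)))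
                        (fLe (tsup (v3 0) (v3 1)) (v3 2))
| ax_inf_l : Lu_axiom fTop (fLe (tinf (v2 0) (v2 1)) (v2 0))
| ax_inf_r : Lu_axiom fTop (fLe (tinf (v2 0) (v2 1)) (v2 1))
| ax_inf_glb : Lu_axiom (fAnd (fLe (v3 2) (v3 0)) (fLe (v3 2) (v3 1)))
                        (fLe (v3 2) (tinf (v3 0) (v3 1)))
| ax_transl : Lu_axiom (fLe (v3 0) (v3 1)) (fLe (tadd (v3 2) (v3 0)) (tadd (v3 2) (v3 1)))
| ax_unit_pos : Lu_axiom (@fTop 0) (fLe tzero tunit)
| ax_strong_unit : Lu_axiom (fLe tzero v1) (fOr (fun k : nat => fLe v1 (tnat_u 1 k))).

Definition Lu_provable n (phi psi : formula n) : Prop := Provable Lu_axiom phi psi.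

Fixpoint nmul (T : Type) (add : T -> T -> T) (z u : T) (k : nat) : T :=
  match k with 0 => z | k.+1 => add (nmul add z u k) u end.

Record lgroup_u := LGroupU {
  car :> Type;
  zero : car; unit : car;
  add : car -> car -> car; opp : car -> car;
  sup : car -> car -> car; inf : car -> car -> car;
  le : car -> car -> Prop;
  addA : forall x y z, add (add x y) z = add x (add y z);
  addC : forall x y, add x y = add y x;
  add0 : forall x, add x zero = x;
  addN : forall x, add x (opp x) = zero;
  le_refl : forall x, le x x;
  le_trans : forall x y z, le x y -> le y z -> le x z;
  le_anti : forall x y, le x y -> le y x -> x = y;
  sup_l : forall x y, le x (sup x y);
  sup_r : forall x y, le y (sup x y);
  sup_lub : forall x y z, le x z -> le y z -> le (sup x y) z;
  inf_l : forall x y, le (inf x y) x;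
  inf_r : forall x y, le (inf x y) y;
  inf_glb : forall x y z, le z x -> le z y -> le z (inf x y);
  le_transl : forall x y t, le x y -> le (add t x) (add t y);
  unit_pos : le zero unit;
  strong_unit : forall x, le zero x -> exists k, le x (nmul add zero unit k)
}.

Section Semantics.
Variable M : lgroup_u.

Fixpoint eval n (e : 'I_n -> M) (t : term n) : M :=
  match t with
  | tvar i => e i
  | tzero => zero M
  | tunit => unit M
  | tadd a b => add (eval e a) (eval e b)
  | topp a => opp (eval e a)
  | tsup a b => sup (eval e a) (eval e b)
  | tinf a b => inf (eval e a) (eval e b)
  end.

Fixpoint sat n (f : formula n) : ('I_n -> M) -> Prop :=
  match f in formula n return ('I_n -> M) -> Prop with
  | @fTop _ => fun _ => True
  | @fAnd _ a b => fun e => sat a e /\ sat b e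
  | @fOr _ K g => fun e => exists i : K, sat (g i) e
  | @fEq _ a b => fun e => eval e a = eval e b
  | @fLe _ a b => fun e => le (eval e a) (eval e b)
  | @fEx _ g => fun e => exists x : M, sat g (scons x e)
  end.

Definition valid n (phi psi : formula n) : Prop :=
  forall e : 'I_n -> M, sat phi e -> sat psi e.

Definition holds (phi : formula 0) : Prop := forall e : 'I_0 -> M, sat phi e.
End Semantics.

Definition fOr_fin (I : Type) (phi : I -> formula 0) (J : list I) : formula 0 :=
  fOr (fun p : {i : I | List.In i J} => phi (proj1_sig p)).

(* Main.v *)
Require Import Defs.
From Stdlib Require List.
From Stdlib Require Import FunctionalExtensionality PropExtensionality.
From Stdlib Require Import ProofIrrelevance ClassicalEpsilon.
From mathcomp Require Import all_boot.

(** For a Horn formula [th] which provably bounds each of its variables by a multiple of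
    the unit, the terms modulo [th]-provable equality form an abelian l-group in which [u]
    is a strong unit, and what its generic point satisfies is exactly what [th] proves.
    By the strong unit axiom every geometric formula is covered by substitution instances
    of such Horn formulae, which gives completeness.  For [th = Top] in the empty context
    the term model consists of closed terms: a sentence true in it is provable, so a
    provable disjunction of sentences already has a provable disjunct. *)

Set Implicit Arguments. Unset Strict Implicit. Unset Printing Implicit Defensive.

Local Notation "phi |-- psi" := (Lu_provable phi psi) (at level 70, no associativity).

(** * Substitution calculus for terms and formulae *)

Definition comp n m p (s : 'I_n -> term m) (r : 'I_m -> term p) : 'I_n -> term p :=
  fun i => tsubst r (s i).

Lemma scons0 T m (a : T) (s : 'I_m -> T) : scons a s ord0 = a.
Proof. by rewrite /scons unlift_none. Qed.

Lemma sconsS T m (a : T) (s : 'I_m -> T) i : scons a s (lift ord0 i) = s i.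
Proof. by rewrite /scons liftK. Qed.

Lemma eq_on_scons T m (f g : 'I_m.+1 -> T) :
  f ord0 = g ord0 -> (forall i, f (lift ord0 i) = g (lift ord0 i)) -> f = g.
Proof.
move=> fg0 fgS; apply: functional_extensionality => i.
by case: (unliftP ord0 i) => [j ->|->].
Qed.

Lemma tsubst_id n (t : term n) : tsubst (@tvar n) t = t.
Proof. by elim: t => //= [a -> b ->|a ->|a -> b ->|a -> b ->]. Qed.

Lemma tsubst_comp n m p (s : 'I_n -> term m) (r : 'I_m -> term p) t :
  tsubst r (tsubst s t) = tsubst (comp s r) t.
Proof. by elim: t => //= [a -> b ->|a ->|a -> b ->|a -> b ->]. Qed.

Lemma sup_subst_id n : sup_subst (@tvar n) = @tvar n.+1.
Proof. by apply: eq_on_scons => [|i]; rewrite /sup_subst ?scons0 ?sconsS. Qed.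

Lemma sup_subst_comp n m p (s : 'I_n -> term m) (r : 'I_m -> term p) :
  comp (sup_subst s) (sup_subst r) = sup_subst (comp s r).
Proof.
apply: eq_on_scons => [|i]; rewrite /comp /sup_subst ?scons0 ?sconsS /= ?scons0 //.
rewrite /tshift !tsubst_comp; congr tsubst.
by apply: functional_extensionality => j; rewrite /comp /= sconsS.
Qed.

Lemma fsubst_id n (f : formula n) : fsubst f (@tvar n) = f.
Proof.
elim: f => //= {n} [n a -> b ->|n I f IH|n a b|n a b|n g IH] //.
- by congr fOr; apply: functional_extensionality.
- by rewrite !tsubst_id.
- by rewrite !tsubst_id.
- by rewrite sup_subst_id IH.
Qed.

Lemma fsubst_comp n (f : formula n) m p (s : 'I_n -> term m) (r : 'I_m -> term p) :
  fsubst (fsubst f s) r = fsubst f (comp s r).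
Proof.
elim: f m p s r => //= {n} [n a IHa b IHb|n I f IH|n a b|n a b|n g IH] m p s r.
- by rewrite IHa IHb.
- by congr fOr; apply: functional_extensionality => i.
- by rewrite !tsubst_comp.
- by rewrite !tsubst_comp.
- by rewrite IH sup_subst_comp.
Qed.

Lemma comp_var_r n m (s : 'I_n -> term m) : comp s (@tvar m) = s.
Proof. by apply: functional_extensionality => i; apply: tsubst_id. Qed.

Lemma compA n m p q (s : 'I_n -> term m) (r : 'I_m -> term p) (t : 'I_p -> term q) :
  comp (comp s r) t = comp s (comp r t).
Proof. by apply: functional_extensionality => i; apply: tsubst_comp. Qed.

Lemma tshiftK n (a t : term n) : tsubst (scons a (@tvar n)) (tshift t) = t.
Proof.
rewrite /tshift tsubst_comp -[RHS]tsubst_id; congr tsubst.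
by apply: functional_extensionality => i; rewrite /comp /= sconsS.
Qed.

Lemma fsubst_shift n m (f : formula n) (r : 'I_n.+1 -> term m) :
  fsubst (fshift f) r = fsubst f (fun i => r (lift ord0 i)).
Proof. by rewrite /fshift fsubst_comp. Qed.

Lemma fshiftK n (a : term n) (f : formula n) : fsubst (fshift f) (scons a (@tvar n)) = f.
Proof.
rewrite fsubst_shift -[RHS]fsubst_id; congr fsubst.
by apply: functional_extensionality => i; rewrite sconsS.
Qed.

(** Instantiating the variable kept free by [sup_subst] gives back an extended substitution; this is
    how witnesses pass through a substituted [fEx]. *)
Lemma sup_subst_scons n m (s : 'I_n -> term m) (a : term m) :
  comp (sup_subst s) (scons a (@tvar m)) = scons a s.
Proof.
by apply: eq_on_scons => [|i]; rewrite /comp /sup_subst ?scons0 ?sconsS /= ?scons0 ?tshiftK.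
Qed.

(** * Soundness in set-based models *)

Section Semantics.
Variable M : lgroup_u.

Lemma eval_subst n m (s : 'I_n -> term m) (e : 'I_m -> M) t :
  eval e (tsubst s t) = eval (fun i => eval e (s i)) t.
Proof. by elim: t => //= [a -> b ->|a ->|a -> b ->|a -> b ->]. Qed.

Lemma sat_subst n (f : formula n) m (s : 'I_n -> term m) (e : 'I_m -> M) :
  sat (fsubst f s) e <-> sat f (fun i => eval e (s i)).
Proof.
elim: f m s e => //= {n} [n a IHa b IHb|n I f IH|n a b|n a b|n g IH] m s e.
- by rewrite IHa IHb.
- by split=> -[i /IH]; exists i.
- by rewrite !eval_subst.
- by rewrite !eval_subst.
- suff E x : (fun i => eval (scons x e) (sup_subst s i))
           = scons x (fun i => eval e (s i)).
    by split=> -[x]; rewrite ?IH => H; exists x; rewrite ?IH ?E // -E.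
  apply: eq_on_scons => [|i]; rewrite /sup_subst ?scons0 ?sconsS /= ?scons0 //.
  by rewrite eval_subst; congr eval; apply: functional_extensionality => j /=; rewrite sconsS.
Qed.

Lemma sat_fshift n (f : formula n) x (e : 'I_n -> M) : sat (fshift f) (scons x e) <-> sat f e.
Proof.
rewrite sat_subst; suff -> : (fun i => eval (scons x e) (tvar (lift ord0 i))) = e by [].
by apply: functional_extensionality => i /=; rewrite sconsS.
Qed.

Lemma eval_tnat_u n (e : 'I_n -> M) k :
  eval e (tnat_u n k) = nmul (@add M) (zero M) (unit M) k.
Proof. by elim: k => //= k ->. Qed.

Lemma Lu_axiom_sound n (phi psi : formula n) : Lu_axiom phi psi -> valid M phi psi.
Proof.
case=> e /=; try by [|case; apply: le_trans|case; apply: le_anti|case; apply: sup_lub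
  |case; apply: inf_glb].
- by move=> _; apply: addA.
- by move=> _; apply: addC.
- by move=> _; apply: add0.
- by move=> _; apply: addN.
- by move=> _; apply: le_refl.
- by move=> _; apply: sup_l.
- by move=> _; apply: sup_r.
- by move=> _; apply: inf_l.
- by move=> _; apply: inf_r.
- exact: le_transl.
- by move=> _; apply: unit_pos.
- by move=> /strong_unit[k ?]; exists k; rewrite eval_tnat_u.
Qed.

Lemma soundness n (phi psi : formula n) : phi |-- psi -> valid M phi psi.
Proof.
elim=> {n phi psi} /=.
- exact: Lu_axiom_sound.
- by move=> n phi e.
- by move=> n phi psi chi _ V1 _ V2 e /V1/V2.
- by move=> n m s phi psi _ V e; rewrite !sat_subst; apply: V.
- by move=> e.
- move=> n phi e /= [E]; rewrite !sat_subst.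
  (* The two substitutions differ only at variable 0, and [E] identifies its two values. *)
  suff -> : (fun i => eval e (@eq_sx n i)) = (fun i => eval e (@eq_sy n i)) by [].
  by apply: eq_on_scons => [|i]; rewrite /eq_sx /eq_sy ?scons0 ?sconsS.
- by move=> n phi e.
- by move=> n phi psi e [].
- by move=> n phi psi e [].
- by move=> n phi psi chi _ V1 _ V2 e H; split; [apply: V1|apply: V2].
- by move=> n I f i e H; exists i.
- by move=> n I f psi _ V e [i /V].
- by move=> n phi psi _ V e [x Hx]; apply/(sat_fshift psi x); apply: V.
- move=> n phi psi _ V e H.
  (* The head of [e] is the existential witness; its tail interprets the context of [psi]. *)
  have E : scons (e ord0) (fun i => e (lift ord0 i)) = e.
    by apply: eq_on_scons => [|i]; rewrite ?scons0 ?sconsS.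
  by rewrite -E sat_fshift; apply: V; exists (e ord0); rewrite E.
- by move=> n phi I f e [H [i]]; exists i.
- by move=> n phi psi e [H [x Hx]]; exists x; split=> /=; first apply/sat_fshift.
Qed.
End Semantics.

(** * Derived rules: equality, ordered-group arithmetic, boundedness *)

Section Derived.
Variable n : nat.
Implicit Types (th phi psi : formula n) (a b c t : term n).

Lemma pr_true th phi : fTop |-- phi -> th |-- phi.
Proof. by apply: pr_cut; apply: pr_top. Qed.

(** The calculus has existential introduction only as an adjunction: its unit, [pr_ex_i] applied to
    the identity, is specialised to the witness [a]. *)
Lemma pr_ex_intro th (phi : formula n.+1) a :
  th |-- fsubst phi (scons a (@tvar n)) -> th |-- fEx phi.
Proof.
move=> H; apply: pr_cut H _.
have /(pr_subst (scons a (@tvar n))) := pr_ex_i (pr_id Lu_axiom (fEx phi)).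
by rewrite fshiftK.
Qed.

Lemma pr_or_intro th I (f : I -> formula n) i : th |-- f i -> th |-- fOr f.
Proof. by move/pr_cut; apply; apply: pr_or_i. Qed.

Lemma pr_or_elim th psi I (f : I -> formula n) :
  (forall i, fAnd th (f i) |-- psi) -> fAnd th (fOr f) |-- psi.
Proof. by move=> H; apply: pr_cut (pr_distr _ _ _) _; apply: pr_or_e. Qed.

Lemma pr_ex_elim th psi (phi : formula n.+1) :
  fAnd (fshift th) phi |-- fshift psi -> fAnd th (fEx phi) |-- psi.
Proof. by move=> H; apply: pr_cut (pr_frob _ _ _) _; apply: pr_ex_e. Qed.

(** The replacement axiom specialised to [a] and [b] at its two leading variables. Later uses shift
    the occurrences that must stay fixed and put [tvar ord0] where rewriting is wanted. *)
Lemma eq_transport th (phi : formula n.+1) a b :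
  th |-- fEq a b -> th |-- fsubst phi (scons a (@tvar n)) ->
  th |-- fsubst phi (scons b (@tvar n)).
Proof.
move=> E H; apply: pr_cut (pr_and_i E H) _.
have /(pr_subst (scons a (scons b (@tvar n)))) := pr_eq_repl Lu_axiom phi.
rewrite /= !fsubst_comp scons0 sconsS scons0.
suff [-> ->] : comp (@eq_sx n) (scons a (scons b (@tvar n))) = scons a (@tvar n)
  /\ comp (@eq_sy n) (scons a (scons b (@tvar n))) = scons b (@tvar n) by [].
by split; apply: eq_on_scons => [|i];
  rewrite /comp /eq_sx /eq_sy ?scons0 ?sconsS /= ?sconsS ?scons0.
Qed.

Lemma peq_refl th a : th |-- fEq a a.
Proof.
by apply: pr_true; have := pr_subst (fun=> a) (pr_eq_refl Lu_axiom).
Qed.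

Lemma peq_congr th (C : term n.+1) a b : th |-- fEq a b ->
  th |-- fEq (tsubst (scons a (@tvar n)) C) (tsubst (scons b (@tvar n)) C).
Proof.
move=> E.
have := eq_transport (phi := fEq (tshift (tsubst (scons a (@tvar n)) C)) C) E.
by rewrite /= !tshiftK; apply; apply: peq_refl.
Qed.

Lemma peq_sym th a b : th |-- fEq a b -> th |-- fEq b a.
Proof.
move=> E; have := eq_transport (phi := fEq (tvar ord0) (tshift a)) E.
by rewrite /= !tshiftK !scons0; apply; apply: peq_refl.
Qed.

Lemma peq_trans th a b c : th |-- fEq a b -> th |-- fEq b c -> th |-- fEq a c.
Proof.
move=> E1 E2; have := eq_transport (phi := fEq (tshift a) (tvar ord0)) E2.
by rewrite /= !tshiftK !scons0; apply.
Qed.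

Lemma peq_opp th a b : th |-- fEq a b -> th |-- fEq (topp a) (topp b).
Proof. by move/(peq_congr (topp (tvar ord0))); rewrite /= !scons0. Qed.

(** The naturality hypothesis on [op] lets one argument serve addition, supremum and infimum; the
    two arguments are rewritten one after the other. *)
Lemma peq_op2 (op : forall k, term k -> term k -> term k) th a a' b b' :
  (forall k l (s : 'I_k -> term l) x y,
     tsubst s (op k x y) = op l (tsubst s x) (tsubst s y)) ->
  th |-- fEq a a' -> th |-- fEq b b' -> th |-- fEq (op n a b) (op n a' b').
Proof.
move=> opE /(peq_congr (op n.+1 (tvar ord0) (tshift b))) Ea.
move=> /(peq_congr (op n.+1 (tshift a') (tvar ord0))) Eb.
move: Ea Eb; rewrite !opE !tshiftK /= !scons0; exact: peq_trans.
Qed.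

(** Axiom variables are numbered, so a list of terms names an instance. Each use supplies one term
    per variable, and the default [tzero] is never read. *)
Lemma pr_axiom_inst k (phi psi : formula k) (l : seq (term n)) th :
  Lu_axiom phi psi -> th |-- fsubst phi (fun i => nth tzero l i) ->
  th |-- fsubst psi (fun i => nth tzero l i).
Proof. by move=> A /pr_cut; apply; apply: pr_subst; apply: pr_ax. Qed.

Lemma padd_assoc th a b c : th |-- fEq (tadd (tadd a b) c) (tadd a (tadd b c)).
Proof.
have := pr_axiom_inst (l := [:: a; b; c]) ax_addA (pr_top _ th).
by rewrite /= !inordK.
Qed.

Lemma padd_comm th a b : th |-- fEq (tadd a b) (tadd b a).
Proof.
by have := pr_axiom_inst (l := [:: a; b]) ax_addC (pr_top _ th); rewrite /= !inordK.
Qed.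

Lemma padd_zero th a : th |-- fEq (tadd a tzero) a.
Proof. exact: (pr_axiom_inst (l := [:: a]) ax_add0 (pr_top _ th)). Qed.

Lemma padd_opp th a : th |-- fEq (tadd a (topp a)) tzero.
Proof. exact: (pr_axiom_inst (l := [:: a]) ax_addN (pr_top _ th)). Qed.

Lemma ple_refl th a : th |-- fLe a a.
Proof. exact: (pr_axiom_inst (l := [:: a]) ax_le_refl (pr_top _ th)). Qed.

Lemma ple_trans th a b c : th |-- fLe a b -> th |-- fLe b c -> th |-- fLe a c.
Proof.
move=> H1 H2; have := pr_axiom_inst (l := [:: a; b; c]) (th := th) ax_le_trans.
by rewrite /= !inordK //; apply; apply: pr_and_i.
Qed.

Lemma ple_anti th a b : th |-- fLe a b -> th |-- fLe b a -> th |-- fEq a b.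
Proof.
move=> H1 H2; have := pr_axiom_inst (l := [:: a; b]) (th := th) ax_le_anti.
by rewrite /= !inordK //; apply; apply: pr_and_i.
Qed.

Lemma psup_l th a b : th |-- fLe a (tsup a b).
Proof.
by have := pr_axiom_inst (l := [:: a; b]) ax_sup_l (pr_top _ th); rewrite /= !inordK.
Qed.

Lemma psup_r th a b : th |-- fLe b (tsup a b).
Proof.
by have := pr_axiom_inst (l := [:: a; b]) ax_sup_r (pr_top _ th); rewrite /= !inordK.
Qed.

Lemma psup_lub th a b c : th |-- fLe a c -> th |-- fLe b c -> th |-- fLe (tsup a b) c.
Proof.
move=> H1 H2; have := pr_axiom_inst (l := [:: a; b; c]) (th := th) ax_sup_lub.
by rewrite /= !inordK //; apply; apply: pr_and_i.
Qed.

Lemma pinf_l th a b : th |-- fLe (tinf a b) a.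
Proof.
by have := pr_axiom_inst (l := [:: a; b]) ax_inf_l (pr_top _ th); rewrite /= !inordK.
Qed.

Lemma pinf_r th a b : th |-- fLe (tinf a b) b.
Proof.
by have := pr_axiom_inst (l := [:: a; b]) ax_inf_r (pr_top _ th); rewrite /= !inordK.
Qed.

Lemma pinf_glb th a b c : th |-- fLe c a -> th |-- fLe c b -> th |-- fLe c (tinf a b).
Proof.
move=> H1 H2; have := pr_axiom_inst (l := [:: a; b; c]) (th := th) ax_inf_glb.
by rewrite /= !inordK //; apply; apply: pr_and_i.
Qed.

Lemma ple_transl th a b c : th |-- fLe a b -> th |-- fLe (tadd c a) (tadd c b).
Proof.
have := pr_axiom_inst (l := [:: a; b; c]) (th := th) ax_transl.
by rewrite /= !inordK.
Qed.

Lemma punit_pos th : th |-- fLe tzero tunit.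
Proof. exact: (pr_axiom_inst (l := [::]) ax_unit_pos (pr_top _ th)). Qed.

Lemma tsubst_nat_u k m (s : 'I_m -> term n) : tsubst s (tnat_u m k) = tnat_u n k.
Proof. by elim: k => //= k ->. Qed.

Lemma pstrong_unit th a :
  th |-- fLe tzero a -> th |-- fOr (fun k => fLe a (tnat_u n k)).
Proof.
move=> H; have := pr_axiom_inst (l := [:: a]) (th := th) ax_strong_unit.
rewrite /= => /(_ H); congr (_ |-- fOr _); apply: functional_extensionality => k.
by rewrite tsubst_nat_u.
Qed.

Lemma peq_le th a b : th |-- fEq a b -> th |-- fLe a b.
Proof.
move=> E; have := eq_transport (phi := fLe (tshift a) (tvar ord0)) E.
by rewrite /= !tshiftK !scons0; apply; apply: ple_refl.
Qed.

Lemma ple_eq th a b c d : th |-- fEq a c -> th |-- fEq b d -> th |-- fLe a b -> th |-- fLe c d.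
Proof.
move=> /peq_sym/peq_le ca /peq_le bd ab; apply: ple_trans ca _; exact: ple_trans bd.
Qed.

Lemma ple_transr th a b c : th |-- fLe a b -> th |-- fLe (tadd a c) (tadd b c).
Proof. by move/(ple_transl c); apply: ple_eq; apply: padd_comm. Qed.

Lemma padd_mono th a b c d :
  th |-- fLe a b -> th |-- fLe c d -> th |-- fLe (tadd a c) (tadd b d).
Proof. move=> /(ple_transr c) H1 /(ple_transl b); exact: ple_trans. Qed.

Lemma pzero_add th a : th |-- fEq (tadd tzero a) a.
Proof. exact: peq_trans (padd_comm _ _ _) (padd_zero _ _). Qed.

Lemma peq_add th a a' b b' :
  th |-- fEq a a' -> th |-- fEq b b' -> th |-- fEq (tadd a b) (tadd a' b').
Proof. exact: (peq_op2 (op := tadd)). Qed.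

Lemma paddKl th a b : th |-- fEq (tadd (topp a) (tadd a b)) b.
Proof.
apply: peq_trans (peq_sym (padd_assoc _ _ _ _)) _.
apply: peq_trans (pzero_add _ _); apply: peq_add (peq_refl _ _).
exact: peq_trans (padd_comm _ _ _) (padd_opp _ _).
Qed.

Lemma padd_CA th a b c : th |-- fEq (tadd a (tadd b c)) (tadd b (tadd a c)).
Proof.
apply: peq_trans (peq_sym (padd_assoc _ _ _ _)) _; apply: peq_trans (padd_assoc _ _ _ _).
exact: peq_add (padd_comm _ _ _) (peq_refl _ _).
Qed.

Lemma padd_ACA th a b c d :
  th |-- fEq (tadd (tadd a b) (tadd c d)) (tadd (tadd a c) (tadd b d)).
Proof.
apply: peq_trans (padd_assoc _ _ _ _) _; apply: peq_trans _ (peq_sym (padd_assoc _ _ _ _)).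
exact: peq_add (peq_refl _ _) (padd_CA _ _ _ _).
Qed.

(** Translate by [a] one way and by [topp a] the other. Lower bounds become sign conditions, which
    can be added. *)
Lemma ple_opp_add th a b : (th |-- fLe (topp a) b) <-> (th |-- fLe tzero (tadd a b)).
Proof.
split=> H.
  by apply: ple_eq (ple_transl a H); [apply: padd_opp|apply: peq_refl].
by apply: ple_eq (ple_transl (topp a) H); [apply: padd_zero|apply: paddKl].
Qed.

Lemma popp_le th a b : th |-- fLe (topp a) b -> th |-- fLe (topp b) a.
Proof.
move=> /ple_opp_add H; apply/ple_opp_add.
by apply: ple_eq H; [apply: peq_refl|apply: padd_comm].
Qed.

Lemma popp_ge th a b : th |-- fLe a b -> th |-- fLe (topp b) (topp a).
Proof.
by move=> H; apply: popp_le; apply: ple_trans H; apply: popp_le; apply: ple_refl.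
Qed.

Lemma ppos_opp th a : th |-- fLe tzero a -> th |-- fLe (topp a) tzero.
Proof.
by move=> H; apply/ple_opp_add; apply: ple_eq H; [apply: peq_refl|apply/peq_sym/padd_zero].
Qed.

Lemma pnat_u_pos th k : th |-- fLe tzero (tnat_u n k).
Proof.
elim: k => [|k IH]; first exact: ple_refl.
by apply: ple_eq (padd_mono IH (punit_pos th)); [apply: padd_zero|apply: peq_refl].
Qed.

Lemma pnat_u_add th k l : th |-- fEq (tadd (tnat_u n k) (tnat_u n l)) (tnat_u n (k + l)).
Proof.
elim: l => [|l IH]; first by rewrite addn0; apply: padd_zero.
rewrite addnS /=; apply: peq_trans (peq_sym (padd_assoc _ _ _ _)) _.
exact: peq_add IH (peq_refl _ _).
Qed.

Lemma pnat_u_mono th k l : k <= l -> th |-- fLe (tnat_u n k) (tnat_u n l).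
Proof.
move=> /subnKC <-.
by apply: ple_eq (ple_transl _ (pnat_u_pos th _)); [apply: padd_zero|apply: pnat_u_add].
Qed.

(** The numeral [k] is chosen outside the logic: [th] proves a bound by one particular multiple of
    the unit, not merely a disjunction over all of them. Bounding on both sides makes the notion
    stable under [topp]. *)
Definition bounded th t :=
  exists k, th |-- fLe t (tnat_u n k) /\ th |-- fLe (topp (tnat_u n k)) t.

(** Bounds add up under [tadd], are kept by [topp], and are replaced by their maximum under [tsup]
    and [tinf]. *)
Lemma bounded_term th t : (forall i, bounded th (tvar i)) -> bounded th t.
Proof.
move=> Hv; elim: t => //= [|| a [k [Ha Ka]] b [l [Hb Lb]]|a [k [Ha Ka]]
  | a [k [Ha Ka]] b [l [Hb Lb]]| a [k [Ha Ka]] b [l [Hb Lb]]].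
- by exists 0; split=> /=; [apply: ple_refl|apply: ppos_opp; apply: ple_refl].
(* The first multiple of the unit is [tadd tzero tunit], only provably equal to [tunit]. *)
- exists 1; split; first by apply/peq_le/peq_sym/pzero_add.
  by apply: ple_trans (ppos_opp (pnat_u_pos _ _)) (punit_pos _).
- exists (k + l); split.
    by apply: ple_trans (peq_le (pnat_u_add _ _ _)); apply: padd_mono.
  apply/ple_opp_add; move/ple_opp_add: Ka => Ka; move/ple_opp_add: Lb => Lb.
  apply: ple_eq (padd_mono Ka Lb); first exact: padd_zero.
  by apply: peq_trans (padd_ACA _ _ _ _ _) _; apply: peq_add (pnat_u_add _ _ _) (peq_refl _ _).
- by exists k; split; [apply: popp_le|apply: popp_ge].
- exists (maxn k l); split.
    apply: psup_lub; [apply: ple_trans Ha _|apply: ple_trans Hb _];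
    by apply: pnat_u_mono; rewrite ?leq_maxl ?leq_maxr.
  apply: ple_trans (psup_l _ _ _); apply: ple_trans Ka.
  by apply/popp_ge/pnat_u_mono/leq_maxl.
- exists (maxn k l); split.
    by apply: ple_trans (pinf_l _ _ _) (ple_trans Ha (pnat_u_mono _ (leq_maxl _ _))).
  apply: pinf_glb; [apply: ple_trans Ka|apply: ple_trans Lb];
    by apply/popp_ge/pnat_u_mono; rewrite ?leq_maxl ?leq_maxr.
Qed.
End Derived.

(** * The term model of a Horn theory that bounds its variables *)

Section TermModel.
Variables (n : nat) (th : formula n).
Hypothesis th_bounded : forall i, bounded th (tvar i).

Definition rep (t : term n) : term n :=
  epsilon (inhabits tzero) (fun s => th |-- fEq t s).

Lemma rep_eq t : th |-- fEq t (rep t).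
Proof. by apply: (epsilon_spec _ (fun s => th |-- fEq t s)); exists t; apply: peq_refl. Qed.

(** Provably equal terms define the same predicate by extensionality, so [epsilon] picks the same
    representative. *)
Lemma eq_rep t s : th |-- fEq t s -> rep t = rep s.
Proof.
move=> E; congr epsilon; apply: functional_extensionality => r.
apply: propositional_extensionality; split; apply: peq_trans => //.
exact: peq_sym.
Qed.

(** The quotient by provable equality, realised as the fixed points of [rep], so that equality of
    classes is plain equality as [lgroup_u] demands. *)
Definition tm_car := {t : term n | rep t = t}.

Definition cls t : tm_car := exist _ (rep t) (eq_rep (peq_sym (rep_eq t))).

Lemma cls_eq t s : cls t = cls s <-> (th |-- fEq t s).
Proof.
split=> [/(congr1 (@proj1_sig _ _)) /= E|/eq_rep E].
  by apply: peq_trans (rep_eq t) _; rewrite E; apply/peq_sym/rep_eq.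
by apply: subset_eq_compat.
Qed.

Lemma cls_val (x : tm_car) : cls (proj1_sig x) = x.
Proof. by case: x => t E; apply: subset_eq_compat. Qed.

Lemma val_cls t : th |-- fEq (proj1_sig (cls t)) t.
Proof. exact/peq_sym/rep_eq. Qed.

Definition tm_op2 (op : term n -> term n -> term n) (x y : tm_car) : tm_car :=
  cls (op (proj1_sig x) (proj1_sig y)).
Definition tm_opp (x : tm_car) : tm_car := cls (topp (proj1_sig x)).
Definition tm_le (x y : tm_car) : Prop := th |-- fLe (proj1_sig x) (proj1_sig y).

Lemma tm_oppE a : tm_opp (cls a) = cls (topp a).
Proof. by apply/cls_eq/peq_opp/val_cls. Qed.

Lemma tm_addE a b : tm_op2 (@tadd n) (cls a) (cls b) = cls (tadd a b).
Proof. by apply/cls_eq; apply: (peq_op2 (op := tadd)) => //; apply: val_cls. Qed.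

Lemma tm_supE a b : tm_op2 (@tsup n) (cls a) (cls b) = cls (tsup a b).
Proof. by apply/cls_eq; apply: (peq_op2 (op := tsup)) => //; apply: val_cls. Qed.

Lemma tm_infE a b : tm_op2 (@tinf n) (cls a) (cls b) = cls (tinf a b).
Proof. by apply/cls_eq; apply: (peq_op2 (op := tinf)) => //; apply: val_cls. Qed.

Lemma tm_leE a b : tm_le (cls a) (cls b) <-> (th |-- fLe a b).
Proof.
by split; apply: ple_eq; rewrite /=; do ?[exact: val_cls|exact: rep_eq].
Qed.

Lemma tm_ind (P : tm_car -> Prop) : (forall t, P (cls t)) -> forall x, P x.
Proof. by move=> H x; rewrite -(cls_val x). Qed.

Lemma tm_nmulE k : nmul (tm_op2 (@tadd n)) (cls tzero) (cls tunit) k = cls (tnat_u n k).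
Proof. by elim: k => //= k ->; rewrite tm_addE. Qed.

(** Here [th_bounded] enters: each class is below one definite multiple of the unit. *)
Lemma tm_strong_unit (x : tm_car) : tm_le (cls tzero) x ->
  exists k, tm_le x (nmul (tm_op2 (@tadd n)) (cls tzero) (cls tunit) k).
Proof.
elim/tm_ind: x => t _; have [k [H _]] := bounded_term t th_bounded.
by exists k; rewrite tm_nmulE tm_leE.
Qed.

(** On classes, every law reduces to a derived rule. The definition stays transparent so that
    [tm_eval] can unfold the operations. *)
Definition term_model : lgroup_u.
Proof.
refine (@LGroupU tm_car (cls tzero) (cls tunit) (tm_op2 (@tadd n)) tm_opp
  (tm_op2 (@tsup n)) (tm_op2 (@tinf n)) tm_le
  _ _ _ _ _ _ _ _ _ _ _ _ _ _ _ tm_strong_unit);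
  repeat (elim/tm_ind => ?);
  rewrite ?(tm_oppE, tm_addE, tm_supE, tm_infE, tm_leE, cls_eq).
- exact: padd_assoc.
- exact: padd_comm.
- exact: padd_zero.
- exact: padd_opp.
- exact: ple_refl.
- exact: ple_trans.
- exact: ple_anti.
- exact: psup_l.
- exact: psup_r.
- exact: psup_lub.
- exact: pinf_l.
- exact: pinf_r.
- exact: pinf_glb.
- exact: ple_transl.
- exact: punit_pos.
Defined.

Definition tm_env m (s : 'I_m -> term n) : 'I_m -> term_model := fun i => cls (s i).

Lemma tm_eval m (s : 'I_m -> term n) t : eval (tm_env s) t = cls (tsubst s t).
Proof.
elim: t => //= [a -> b ->|a ->|a -> b ->|a -> b ->].
- exact: tm_addE.
- exact: tm_oppE.
- exact: tm_supE.
- exact: tm_infE.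
Qed.

(** A disjunction true in the model has a true disjunct, and a true existential has a witness that
    is the class of a term; both give introduction rules, so the induction covers all geometric
    formulae. *)
Lemma tm_truth m (f : formula m) (s : 'I_m -> term n) :
  sat f (tm_env s) -> th |-- fsubst f s.
Proof.
elim: f s => /= {m} [m|m a IHa b IHb|m I f IH|m a b|m a b|m g IH] s.
- by move=> _; apply: pr_top.
- by case=> /IHa Ha /IHb Hb; apply: pr_and_i.
- by case=> i /IH; apply: (pr_or_intro (f := fun i => fsubst (f i) s)).
- by rewrite !tm_eval => /cls_eq.
- by rewrite !tm_eval => /tm_leE.
- case=> x; elim/tm_ind: x => t H.
  apply: (pr_ex_intro (a := t)); rewrite fsubst_comp sup_subst_scons; apply: IH.
  suff -> : tm_env (scons t s) = scons (cls t) (tm_env s) by [].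
  by apply: eq_on_scons => [|i]; rewrite /tm_env ?scons0 ?sconsS.
Qed.
End TermModel.

(** * Covering formulae by bounded Horn formulae *)

Inductive horn n : formula n -> Prop :=
| horn_top : horn fTop
| horn_and a b : horn a -> horn b -> horn (fAnd a b)
| horn_eq s t : horn (fEq s t)
| horn_le s t : horn (fLe s t).

Lemma horn_subst n m (f : formula n) (s : 'I_n -> term m) : horn f -> horn (fsubst f s).
Proof. by elim=> /= *; constructor. Qed.

(** A converse to [tm_truth]. It is confined to Horn formulae because a provable disjunction or
    existential may lack a provable instance. *)
Lemma horn_sat n (th : formula n) (H : forall i, bounded th (tvar i)) m
    (f : formula m) (s : 'I_m -> term n) :
  horn f -> th |-- fsubst f s -> sat f (tm_env H s).
Proof.
elim=> //= [a b _ IHa _ IHb E|t r E|t r E].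
- split; [apply: IHa|apply: IHb]; apply: pr_cut E _; [exact: pr_and_l|exact: pr_and_r].
- by rewrite !tm_eval; apply/cls_eq.
- by rewrite !tm_eval; apply/tm_leE.
Qed.

(* Every geometric formula is a disjunction of existentially quantified Horn formulae;
   [chi] carries the rest of the context, as geometric logic has no implication. *)
Lemma horn_cover n (f : formula n) m (s : 'I_n -> term m) (al chi psi : formula m) :
  horn al ->
  (forall p (r : 'I_m -> term p) (be : formula p), horn be ->
     be |-- fsubst al r -> be |-- fsubst f (comp s r) ->
     fAnd be (fsubst chi r) |-- fsubst psi r) ->
  fAnd (fAnd al chi) (fsubst f s) |-- psi.
Proof.
elim: f m s al chi psi => /= {n}
  [n|n a IHa b IHb|n I f IH|n a b|n a b|n g IH] m s al chi psi Hal H.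
- have := H _ (@tvar m) al Hal; rewrite !fsubst_id => {}H.
  by apply: pr_cut (pr_and_l _ _ _) (H (pr_id _ _) (pr_top _ _)).
(* The second conjunct is parked in the context part [chi] while the first is decomposed. *)
- apply: (@pr_cut _ _ _ (fAnd (fAnd al (fAnd chi (fsubst b s))) (fsubst a s))).
    have L := pr_and_l Lu_axiom; have R := pr_and_r Lu_axiom.
    repeat apply: pr_and_i.
    + exact: pr_cut (L _ _ _) (L _ _ _).
    + exact: pr_cut (L _ _ _) (R _ _ _).
    + exact: pr_cut (R _ _ _) (R _ _ _).
    + exact: pr_cut (R _ _ _) (L _ _ _).
  apply: IHa => // p r be Hbe Eal Ea /=.
  apply: (@pr_cut _ _ _ (fAnd (fAnd be (fsubst chi r)) (fsubst b (comp s r)))).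
    have L := pr_and_l Lu_axiom; have R := pr_and_r Lu_axiom.
    rewrite fsubst_comp; repeat apply: pr_and_i.
    + exact: L.
    + exact: pr_cut (R _ _ _) (L _ _ _).
    + exact: pr_cut (R _ _ _) (R _ _ _).
  (* What [be] proves about [al] and the first conjunct is carried to [ga] by substituting along
     [t]. *)
  apply: IHb => // q t ga Hga Ebe Eb.
  rewrite !fsubst_comp; apply: H => //.
    by apply: pr_cut Ebe _; rewrite -fsubst_comp; apply: pr_subst.
  apply: pr_and_i; last by rewrite -compA.
  by apply: pr_cut Ebe _; rewrite -compA -fsubst_comp; apply: pr_subst.
- apply: (pr_or_elim (f := fun i => fsubst (f i) s)) => i; apply: IH => // p r be Hbe E1 E2.
  by apply: H => //; apply: (pr_or_intro (f := fun i => fsubst (f i) (comp s r))) E2.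
(* Atoms are absorbed into the Horn part, without changing the context. *)
- have := H _ (@tvar m) (fAnd al (fEq (tsubst s a) (tsubst s b))) (horn_and Hal (horn_eq _ _)).
  rewrite !fsubst_id comp_var_r => {}H.
  apply: pr_cut (H (pr_and_l _ _ _) (pr_and_r _ _ _)).
  have L := pr_and_l Lu_axiom; have R := pr_and_r Lu_axiom.
  repeat apply: pr_and_i; [exact: pr_cut (L _ _ _) (L _ _ _)|exact: R|].
  exact: pr_cut (L _ _ _) (R _ _ _).
- have := H _ (@tvar m) (fAnd al (fLe (tsubst s a) (tsubst s b))) (horn_and Hal (horn_le _ _)).
  rewrite !fsubst_id comp_var_r => {}H.
  apply: pr_cut (H (pr_and_l _ _ _) (pr_and_r _ _ _)).
  have L := pr_and_l Lu_axiom; have R := pr_and_r Lu_axiom.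
  repeat apply: pr_and_i; [exact: pr_cut (L _ _ _) (L _ _ _)|exact: R|].
  exact: pr_cut (L _ _ _) (R _ _ _).
- apply: pr_ex_elim => /=; apply: IH; first exact: horn_subst.
  move=> p r be Hbe; rewrite !fsubst_shift => Eal Eg; apply: H => //.
  (* The bound variable was added to the context, so its image under [r] is the witness. *)
  apply: (pr_ex_intro (a := r ord0)); rewrite fsubst_comp sup_subst_scons.
  suff -> : scons (r ord0) (comp s (fun i => r (lift ord0 i))) = comp (sup_subst s) r by [].
  apply: eq_on_scons => [|i]; rewrite /comp /sup_subst ?scons0 ?sconsS //.
  by rewrite /tshift tsubst_comp.
Qed.

(** The strong unit axiom speaks of nonnegative elements only, so it is applied to [tsup tzero t],
    which dominates [t]. *)
Lemma pbounded_above n (th psi : formula n) t :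
  (forall k, fAnd th (fLe t (tnat_u n k)) |-- psi) -> th |-- psi.
Proof.
move=> H; apply: (@pr_cut _ _ _ (fAnd th (fOr (fun k => fLe (tsup tzero t) (tnat_u n k))))).
  by apply: pr_and_i (pr_id _ _) _; apply: pstrong_unit; apply: psup_l.
apply: pr_or_elim => k; apply: pr_cut (H k).
apply: pr_and_i (pr_and_l _ _ _) _.
by apply: ple_trans (psup_r _ _ _) (pr_and_r _ _ _).
Qed.

(** Variable by variable, split on an upper bound of the variable and one of its opposite, adding
    both inequalities to the Horn formula. *)
Lemma bounded_cover n (l : seq 'I_n) (al psi : formula n) :
  horn al ->
  (forall be, horn be -> be |-- al -> (forall i, i \in l -> bounded be (tvar i)) ->
     be |-- psi) ->
  al |-- psi.
Proof.
elim: l al => [|j l IH] al Hal H; first by apply: H => //; apply: pr_id.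
apply: (pbounded_above (t := tvar j)) => k.
apply: (pbounded_above (t := topp (tvar j))) => k'.
apply: IH => [|be Hbe E bl]; first by do 2?[apply: horn_and]=> //; constructor.
have L := pr_and_l Lu_axiom; have R := pr_and_r Lu_axiom.
apply: H => //; first by apply: pr_cut E (pr_cut (L _ _ _) (L _ _ _)).
(* [bounded] asks for a single numeral for both sides, hence the maximum. *)
move=> i; rewrite inE => /orP[/eqP ->|/bl //]; exists (maxn k k'); split.
  apply: ple_trans (pnat_u_mono _ (leq_maxl _ _)).
  by apply: pr_cut E (pr_cut (L _ _ _) (R _ _ _)).
apply: popp_le; apply: ple_trans (pnat_u_mono _ (leq_maxr _ _)).
exact: pr_cut E (R _ _ _).
Qed.

(** * Completeness and compactness *)

Lemma completeness n (phi psi : formula n) :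
  (forall M : lgroup_u, valid M phi psi) -> phi |-- psi.
Proof.
move=> V; apply: (@pr_cut _ _ _ (fAnd (fAnd fTop fTop) (fsubst phi (@tvar n)))).
  by rewrite fsubst_id; repeat apply: pr_and_i; do ?[exact: pr_top|exact: pr_id].
apply: horn_cover; first exact: horn_top.
move=> p r be Hbe _ Ephi; apply: pr_cut (pr_and_l _ _ _) _.
apply: (bounded_cover (l := enum 'I_p)) => // ga Hga Ega bga.
have B i : bounded ga (tvar i) by apply: bga; rewrite mem_enum.
(* At the generic point, which sends each variable to its own class, substituting [s] amounts to
   evaluating in the environment of the classes of [s]. *)
have genE m (f : formula m) (s : 'I_m -> term p) :
    sat (fsubst f s) (tm_env B (@tvar p)) <-> sat f (tm_env B s).
  rewrite sat_subst; suff -> : (fun i => eval (tm_env B (@tvar p)) (s i)) = tm_env B s by [].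
  by apply: functional_extensionality => i; rewrite tm_eval tsubst_id.
apply: tm_truth (B) _ _ _ _; apply: V; rewrite -genE.
(* The generic point satisfies [ga], hence [be], hence the instance of [phi], by soundness. *)
apply: (soundness Ephi); apply: (soundness Ega).
by apply: horn_sat => //; rewrite fsubst_id; apply: pr_id.
Qed.

(** The empty context has no variables to bound, so [fTop] has a term model. This one model selects
    the index, and [tm_truth] makes truth there provability. *)
Lemma supercompactness (I : Type) (phi : I -> formula 0) :
  (forall M : lgroup_u, exists i, holds M (phi i)) -> exists i, fTop |-- phi i.
Proof.
have B (i : 'I_0) : bounded (@fTop 0) (tvar i) by case: i.
move=> /(_ (term_model B)) [i Hi]; exists i.
by rewrite -[phi i]fsubst_id; apply: tm_truth (B) _ _ _ (Hi _).
Qed.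

Lemma provable_holds (phi : formula 0) M : fTop |-- phi -> holds M phi.
Proof. by move=> /(@soundness M) H e; apply: H. Qed.

Theorem theorem5p9 :
  (* (i) completeness of L_u w.r.t. abelian l-groups with strong unit in Set *)
  (forall (n : nat) (phi psi : formula n),
      (forall M : lgroup_u, valid M phi psi) <-> Lu_provable phi psi)
  /\
  (* (ii) compactness for disjunctions of geometric sentences *)
  (forall (I : Type) (phi : I -> formula 0),
      (Lu_provable fTop (fOr phi) <->
         exists J : list I, Lu_provable fTop (fOr_fin phi J))
      /\
      ((forall M : lgroup_u, exists i : I, holds M (phi i)) <->
         exists J : list I, forall M : lgroup_u,
           exists i : I, List.In i J /\ holds M (phi i))).
Proof.
split=> [n phi psi|I phi].
  by split; [apply: completeness|move=> H M; apply: soundness].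
(* A sentence has just one environment, so satisfaction in some environment gives [holds]. *)
have ord0_empty (M : lgroup_u) (e e' : 'I_0 -> M) : e = e'.
  by apply: functional_extensionality => -[].
split; split.
- move=> H; have [M|i Hi] := @supercompactness I phi.
    have e : 'I_0 -> M by case.
    have [|i Hi] := @soundness M _ _ _ H e; first by [].
    by exists i => e'; rewrite (ord0_empty _ e' e).
  (* A single provable disjunct already suffices, so the finite subset is a singleton. *)
  exists [:: i].
  have iJ : List.In i [:: i] by left.
  exact: (@pr_or_intro _ _ _ (fun p : {j | List.In j [:: i]} => phi (proj1_sig p))
    (exist _ i iJ)).
- case=> J H; apply: pr_cut H _; apply: pr_or_e => p; exact: pr_or_i.
- move=> /supercompactness[i Hi]; exists [:: i] => M; exists i; split; first by left.
  exact: provable_holds.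
- by case=> J H M; have [i [_ Hi]] := H M; exists i.
Qed.
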